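(* Let $L$ be a loop and $G$ a middle and right nuclear normal subgroup of $L$. Then $L$ has an automorphism-free Schreier decomposition with respect to $G$ if and only if one of the following equivalent conditions is fulfilled: (A) the image of the map $\mathrm{T}:L\to\mathrm{Aut}(G)$ consists of inner automorphisms; (B) there exists a left transversal of $L/G$ which is contained in the commutant $\mathcal{C}_L(G)$ of $G$ in $L$.
   Context: A subgroup $G$ of a loop $L$ is middle (right) nuclear if it is contained in the middle nucleus $\{u: xu\cdot y=x\cdot uy\ \forall x,y\in L\}$ (right nucleus $\{u: xy\cdot u=x\cdot yu\ \forall x,y\in L\}$). For $x\in L$, $\mathrm{T}_x:G\to G$ is the automorphism of $G$ defined by $\mathrm{T}_x(g)\,x=x\,g$; $\mathrm{T}$ is the map $x\mapsto\mathrm{T}_x$. The commutant is $\mathcal{C}_L(G)=\{u\in L: ux=xu\ \text{for all } x\in G\}$. A left transversal of $L/G$ is a subset of $L$ consisting of exactly one representative of each left coset of $G$ and containing the identity of $L$. Let $K$ be a loop with identity $\epsilon$ and $e$ the identity of $G$. For maps $f:K\times K\to G$ and $\Theta:K\to\mathrm{Aut}(G)$ with $f(\sigma,\epsilon)=f(\epsilon,\sigma)=e$ and $\Theta_\epsilon=\mathrm{Id}$, the Schreier extension $K\times_f^{\Theta}G$ is the loop on $K\times G$ with multiplication $(\sigma,s)(\tau,t)=(\sigma\tau,f(\sigma,\tau)\Theta_\tau(s)t)$. It is automorphism-free if $\Theta_\sigma=\mathrm{Id}$ for all $\sigma\in K$. A Schreier decomposition of $L$ with respect to $G$ is an isomorphism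 $\mathcal{F}$ of some Schreier extension $K\times_f^{\Theta}G$ onto $L$ with $\mathcal{F}(\epsilon,t)=t$ for all $t\in G$; it is called automorphism-free if the Schreier extension is. *)

(* Defs.v *)
From HB Require Import structures.
From mathcomp Require Import all_boot.
From mathcomp Require Import boolp classical_sets.

Set Implicit Arguments.
Unset Strict Implicit.
Unset Printing Implicit Defensive.

Import Algebra.
Local Open Scope classical_set_scope.
Local Open Scope group_scope.

HB.mixin Record UMagma_isLoop L of UMagma L := {
  ldiv : L -> L -> L;
  rdiv : L -> L -> L;
  mulldiv : forall x y : L, x * ldiv x y = y;
  ldivmul : forall x y : L, ldiv x (x * y) = y;
  rdivmul : forall x y : L, rdiv x y * y = x;
  mulrdiv : forall x y : L, rdiv (x * y) y = x
}.

#[short(type="loopType")]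
HB.structure Definition Loop := { L of UMagma_isLoop L & UMagma L }.

Lemma loop_mulI (L : loopType) (x : L) : injective (fun y : L => x * y).
Proof. exact: can_inj (@ldivmul L x). Qed.

Lemma loop_mulIr (L : loopType) (y : L) : injective (fun x : L => x * y).
Proof. by apply: (can_inj (g := fun x => rdiv x y)) => x; exact: mulrdiv. Qed.

Record subgroup (L : loopType) := Subgroup {
  sg_set :> set L;
  sg1 : sg_set 1;
  sgM : forall x y, sg_set x -> sg_set y -> sg_set (x * y);
  sg_ldiv : forall x y, sg_set x -> sg_set y -> sg_set (ldiv x y);
  sg_rdiv : forall x y, sg_set x -> sg_set y -> sg_set (rdiv x y);
  sgA : forall x y z, sg_set x -> sg_set y -> sg_set z ->
    x * (y * z) = (x * y) * z
}.

Definition sg_type (L : loopType) (G : subgroup L) : Type :=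
  {x : L | x \in sg_set G}.

Section SubgroupType.
Variables (L : loopType) (G0 : subgroup L).
Local Notation G := (sg_type G0).
Implicit Types s t u : G.

HB.instance Definition _ := SubChoice.on G.

Let mulG s t : G := SigSub (mem_set (sgM (set_valP s) (set_valP t))).
Let oneG : G := SigSub (mem_set (sg1 G0)).
Let invG s : G := SigSub (mem_set (sg_ldiv (set_valP s) (sg1 G0))).

Let mulGA : associative mulG.
Proof.
by move=> s t u; apply: val_inj; apply: sgA; exact: set_valP.
Qed.

Let mul1G : left_id oneG mulG.
Proof. by move=> s; apply: val_inj; exact: mul1g. Qed.

Let mulG1 : right_id oneG mulG.
Proof. by move=> s; apply: val_inj; exact: mulg1. Qed.

Let mulGV : right_inverse oneG invG mulG.
Proof. by move=> s; apply: val_inj; exact: mulldiv. Qed.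

Let mulVG : left_inverse oneG invG mulG.
Proof.
move=> s; rewrite -[LHS]mulG1 -(mulGV (invG s)) mulGA -(mulGA _ s) mulGV.
by rewrite mulG1 mulGV.
Qed.

HB.instance Definition _ :=
  isGroup.Build G mulGA mul1G mulG1 mulVG mulGV.

Lemma val_sgM s t : val (s * t) = val s * val t :> L.
Proof. by []. Qed.

Lemma val_sg1 : val (1 : G) = 1 :> L.
Proof. by []. Qed.

End SubgroupType.

Section LoopNotions.
Variable L : loopType.
Implicit Types (x y u : L) (A G : set L).

Definition lcoset x G : set L := [set x * g | g in G].
Definition rcoset G x : set L := [set g * x | g in G].

(* The kernels of loop homomorphisms: xG = Gx, (xG)y = x(Gy), x(yG) = (xy)G. *)
Definition normal_subloop G : Prop := forall x y,
  [/\ lcoset x G = rcoset G x,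
      [set u * y | u in lcoset x G] = [set x * u | u in rcoset G y] &
      [set x * u | u in lcoset y G] = lcoset (x * y) G].

Definition middle_nucleus : set L :=
  [set u | forall x y, (x * u) * y = x * (u * y)].

Definition right_nucleus : set L :=
  [set u | forall x y, (x * y) * u = x * (y * u)].

Definition commutant G : set L := [set u | forall x, G x -> u * x = x * u].

Definition left_transversal G A : Prop :=
  A 1 /\ forall x, exists! u, (A `&` lcoset x G) u.

End LoopNotions.

Arguments middle_nucleus L : clear implicits.
Arguments right_nucleus L : clear implicits.

Record automorphism (G : groupType) := Automorphism {
  aut_fun :> {multiplicative G -> G};
  aut_bij : bijective aut_fun
}.

Definition inner (G : groupType) (phi : automorphism G) : Prop :=
  exists h : G, forall g, phi g = g ^ h.

Section TMap.
Variables (L : loopType) (G : subgroup L).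
Hypothesis nG : normal_subloop G.
Hypothesis mG : G `<=` middle_nucleus L.
Hypothesis rG : G `<=` right_nucleus L.

Lemma T_closed (x : L) (g : sg_type G) : rdiv (x * val g) x \in (G : set L).
Proof.
have [E _ _] := nG x x.
have : lcoset x G (x * val g) by exists (val g) => //; exact: set_valP.
by rewrite E => -[h Gh <-]; rewrite mulrdiv; exact: mem_set.
Qed.

(* The element T_x(g) of G with T_x(g) x = x g. *)
Definition T_fun (x : L) (g : sg_type G) : sg_type G := SigSub (T_closed x g).

Lemma T_funE (x : L) (g : sg_type G) : val (T_fun x g) * x = x * val g.
Proof. exact: rdivmul. Qed.

Lemma T_funM (x : L) : {morph T_fun x : g h / g * h}.
Proof.
move=> g h; apply: val_inj; apply: (@loop_mulIr L x).
rewrite [LHS]T_funE [RHS](_ : _ = val (T_fun x g) * val (T_fun x h) * x) //.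
rewrite val_sgM -(rG (set_valP h)) -T_funE (rG (set_valP h)) -T_funE.
by rewrite (mG (set_valP (T_fun x h))).
Qed.

Lemma T_fun_bij (x : L) : bijective (T_fun x).
Proof.
have cl (g : sg_type G) : ldiv x (val g * x) \in (G : set L).
  have [E _ _] := nG x x.
  have : rcoset G x (val g * x) by exists (val g) => //; exact: set_valP.
  by rewrite -E => -[h Gh <-]; rewrite ldivmul; exact: mem_set.
exists (fun g => SigSub (cl g)) => g; apply: val_inj => /=.
  by rewrite rdivmul ldivmul.
by rewrite mulldiv mulrdiv.
Qed.

HB.instance Definition _ (x : L) :=
  isMultiplicative.Build (sg_type G) (sg_type G) (T_fun x) (T_funM x).

Definition T_aut (x : L) : automorphism (sg_type G) :=
  @Automorphism _ (T_fun x : {multiplicative sg_type G -> sg_type G}) (T_fun_bij x).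

End TMap.

Record schreier_data (K : loopType) (G : groupType) := SchreierData {
  sch_f : K -> K -> G;
  sch_Theta : K -> automorphism G;
  sch_f1r : forall sigma, sch_f sigma 1 = 1;
  sch_f1l : forall sigma, sch_f 1 sigma = 1;
  sch_Theta1 : sch_Theta 1 =1 id
}.

Definition automorphism_free (K : loopType) (G : groupType)
    (D : schreier_data K G) : Prop :=
  forall sigma, sch_Theta D sigma =1 id.

Definition schreier_ext (K : loopType) (G : groupType) (D : schreier_data K G)
  : Type := (K * G)%type.

Section SchreierExt.
Variables (K : loopType) (G : groupType) (D : schreier_data K G).
Local Notation E := (schreier_ext D).
Local Notation f := (sch_f D).
Local Notation Theta := (sch_Theta D).

HB.instance Definition _ := Choice.copy E (K * G)%type.

Definition schreier_mul (x y : E) : E :=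
  (x.1 * y.1, f x.1 y.1 * Theta y.1 x.2 * y.2).

HB.instance Definition _ := hasMul.Build E schreier_mul.

Let oneE : E := (1, 1).

Let mul1E : left_id oneE schreier_mul.
Proof.
case=> sigma s; rewrite /schreier_mul /= mul1g sch_f1l mul1g.
have e : Theta sigma 1 * Theta sigma 1 = Theta sigma 1 * 1.
  by rewrite -gmulfM !mulg1.
by rewrite (mulgI _ _ _ e) mul1g.
Qed.

Let mulE1 : right_id oneE schreier_mul.
Proof.
by case=> sigma s; rewrite /schreier_mul /= mulg1 sch_f1r sch_Theta1 mul1g mulg1.
Qed.

HB.instance Definition _ := Magma_isUMagma.Build E mul1E mulE1.

Lemma schreier_mulE (x y : E) :
  x * y = (x.1 * y.1, f x.1 y.1 * Theta y.1 x.2 * y.2) :> E.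
Proof. by []. Qed.

Let rdiv_ex (x y : E) : exists z : E, z * y = x.
Proof.
case: x y => [rho r] [tau t].
have [g gK Kg] := aut_bij (Theta tau).
pose sigma := rdiv rho tau.
exists (sigma, g ((f sigma tau)^-1 * (r * t^-1))).
rewrite schreier_mulE /=.
by rewrite rdivmul Kg !mulgA mulgV mul1g -mulgA mulVg mulg1.
Qed.

Let rdivE (x y : E) : E := sval (cid (rdiv_ex x y)).

Let ldivE (x y : E) : E :=
  let tau := ldiv x.1 y.1 in
  (tau, (f x.1 tau * Theta tau x.2)^-1 * y.2).

Let mulldivE (x y : E) : x * ldivE x y = y.
Proof.
case: x y => [sigma s] [rho r].
rewrite schreier_mulE /=.
by rewrite mulldiv mulVKg.
Qed.

Let ldivmulE (x y : E) : ldivE x (x * y) = y.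
Proof. by case: x y => [sigma s] [tau t]; rewrite /ldivE /= ldivmul mulKg. Qed.

Let rdivmulE (x y : E) : rdivE x y * y = x.
Proof. exact: (svalP (cid (rdiv_ex x y))). Qed.

Let mulIE (x y z : E) : x * z = y * z -> x = y.
Proof.
case: x y z => [rho r] [sigma s] [tau t] [/loop_mulIr <-].
by move=> /mulIg/mulgI/(bij_inj (aut_bij _)) <-.
Qed.

Let mulrdivE (x y : E) : rdivE (x * y) y = x.
Proof. by apply: (@mulIE _ _ y); rewrite rdivmulE. Qed.

HB.instance Definition _ :=
  UMagma_isLoop.Build E mulldivE ldivmulE rdivmulE mulrdivE.

End SchreierExt.

Definition schreier_decomposition (L : loopType) (G : subgroup L)
    (K : loopType) (D : schreier_data K (sg_type G)) (F : schreier_ext D -> L)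
    : Prop :=
  [/\ bijective F, {morph F : x y / x * y} &
      forall t : sg_type G, F (1, t) = val t].

Definition has_automorphism_free_decomposition
    (L : loopType) (G : subgroup L) : Prop :=
  exists (K : loopType) (D : schreier_data K (sg_type G))
         (F : schreier_ext D -> L),
    schreier_decomposition F /\ automorphism_free D.

(* Main.v *)
Require Import Defs.
From HB Require Import structures.
From mathcomp Require Import all_boot.
From mathcomp Require Import boolp classical_sets.

Set Implicit Arguments.
Unset Strict Implicit.
Unset Printing Implicit Defensive.

Import Algebra.
Local Open Scope classical_set_scope.
Local Open Scope group_scope.

(** Given a left transversal [A] of commutant elements, [A] with the product
  "representative of [x * y]" is a copy of [L/G], and since [s * y = y * s] for
  [y] in [A] and [s] in [G], the map [(x, s) |-> x * s] is a decomposition with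
  trivial automorphisms. Conversely, in an automorphism-free decomposition
  [T_x] for [x = F (sigma, s)] is the conjugation [g |-> s g s^-1]. Finally, if
  [T_x (g) = h^-1 g h], then [x h] commutes with [G], so that every coset
  contains an element of the commutant. *)

(** * Left cosets of [G] and translations *)

Section Cosets.
Context {L : loopType} {G : subgroup L}.
Hypothesis rG : G `<=` right_nucleus L.
Implicit Types x y z : L.

Lemma lcoset_refl x : lcoset x G x.
Proof. by exists 1; [exact: sg1|exact: mulg1]. Qed.

Lemma lcoset_eq x y : lcoset x G y -> lcoset y G = lcoset x G.
Proof.
case=> g Gg <-; apply/seteqP; split=> _ [h Gh <-].
  by exists (g * h); [exact: sgM|rewrite (rG Gh)].
exists (ldiv g h); first exact: sg_ldiv.
by rewrite (rG (sg_ldiv Gg Gh)) mulldiv.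
Qed.

(** Forward, a translation respects cosets; backward, it can be cancelled. The two directions give
    the two left division laws on a transversal. *)
Lemma lcosetMl z x y : lcoset x G y <-> lcoset (z * x) G (z * y).
Proof.
split=> -[g Gg].
  by move=> <-; exists g; rewrite // (rG Gg).
by rewrite (rG Gg) => /loop_mulI <-; exists g.
Qed.

Hypothesis nG : normal_subloop G.
Hypothesis mG : G `<=` middle_nucleus L.

(** By normality [g * z = z * h] with [h] in [G], so [(x * g) * z = x * (g * z) = x * (z * h) = (x *
    z) * h]; the converse starts from [z * g = h * z] and cancels [z]. *)
Lemma lcosetMr z x y : lcoset x G y <-> lcoset (x * z) G (y * z).
Proof.
have [E _ _] := nG z z; split=> -[g Gg].
  move=> <-; have : lcoset z G (g * z) by rewrite E; exists g.
  by case=> h Gh e; exists h; rewrite // (rG Gh) e (mG Gg).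
rewrite (rG Gg); have : rcoset G z (z * g) by rewrite -E; exists g.
by case=> h Gh <-; rewrite -(mG Gh) => /loop_mulIr <-; exists h.
Qed.

End Cosets.

(** * Representatives in a left transversal *)

Section TransversalRepresentative.
Context {L : loopType} {G : subgroup L} {A : set L}.
Hypothesis rG : G `<=` right_nucleus L.
Hypothesis tA : left_transversal G A.

Definition coset_repr (x : L) : L := sval (cid (tA.2 x)).

Lemma coset_repr_in x : A (coset_repr x).
Proof. by rewrite /coset_repr; case: cid => u [[]]. Qed.

Lemma coset_repr_lcoset x : lcoset x G (coset_repr x).
Proof. by rewrite /coset_repr; case: cid => u [[]]. Qed.

Lemma coset_repr_eq x u : A u -> lcoset x G u -> coset_repr x = u.
Proof.
by move=> Au xu; rewrite /coset_repr; case: cid => v [_ uniq_v] /=; apply: uniq_v.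
Qed.

Lemma eq_coset_repr x y : (coset_repr x = coset_repr y) <-> lcoset x G y.
Proof.
split=> [e|xy].
  rewrite -(lcoset_eq rG (coset_repr_lcoset x)) e.
  by rewrite (lcoset_eq rG (coset_repr_lcoset y)); exact: lcoset_refl.
apply: coset_repr_eq; first exact: coset_repr_in.
by rewrite -(lcoset_eq rG xy); exact: coset_repr_lcoset.
Qed.

Lemma coset_repr_id x : A x -> coset_repr x = x.
Proof. by move=> Ax; apply: coset_repr_eq => //; exact: lcoset_refl. Qed.

End TransversalRepresentative.

Arguments coset_repr {L G A}.

(** * The quotient loop carried by a transversal, and its extension by [G] *)

Definition id_automorphism (H : groupType) : automorphism H :=
  @Automorphism H idfun (inv_bij (frefl _)).

(* The hypotheses are phantom parameters: the loop structure found on this type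
  by canonical inference depends on them. *)
Definition transversal_loop (L : loopType) (G : subgroup L) (A : set L)
  (nG : normal_subloop G) (mG : G `<=` middle_nucleus L)
  (rG : G `<=` right_nucleus L) (tA : left_transversal G A) : Type :=
  {x : L | x \in A}.

Section TransversalLoop.
Context {L : loopType} {G : subgroup L} {A : set L}.
Context (nG : normal_subloop G) (mG : G `<=` middle_nucleus L).
Context (rG : G `<=` right_nucleus L) (tA : left_transversal G A).
Local Notation K := (transversal_loop nG mG rG tA).
Implicit Types x y z : K.

HB.instance Definition _ := SubChoice.on K.

(** Plays the role of the quotient map from [L] to [L/G]. *)
Definition class_of (u : L) : K := SigSub (mem_set (coset_repr_in tA u)).

Lemma class_of_eq u v : class_of u = class_of v <-> lcoset u G v.
Proof.
rewrite -(eq_coset_repr rG tA); split=> [/(congr1 val)//|e].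
exact: val_inj.
Qed.

Lemma class_of_val x : class_of (val x) = x.
Proof. by apply: val_inj; apply: coset_repr_id; exact: set_valP. Qed.

Lemma lcoset_class_of u : lcoset (val (class_of u)) G u.
Proof. by apply/class_of_eq; rewrite class_of_val. Qed.

Let mulK x y : K := class_of (val x * val y).
Let oneK : K := SigSub (mem_set tA.1).
Let ldivK x y : K := class_of (ldiv (val x) (val y)).
Let rdivK x y : K := class_of (rdiv (val x) (val y)).

HB.instance Definition _ := hasMul.Build K mulK.

Let mul1K : left_id oneK mulK.
Proof. by move=> x; rewrite /mulK mul1g class_of_val. Qed.

Let mulK1 : right_id oneK mulK.
Proof. by move=> x; rewrite /mulK mulg1 class_of_val. Qed.

HB.instance Definition _ := Magma_isUMagma.Build K mul1K mulK1.

Let mulldivK x y : x * ldivK x y = y.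
Proof.
rewrite -[RHS]class_of_val; apply/class_of_eq.
rewrite -[X in lcoset _ _ X](mulldiv (val x)).
by apply: (iffLR (lcosetMl rG _ _ _)); exact: lcoset_class_of.
Qed.

Let ldivmulK x y : ldivK x (x * y) = y.
Proof.
rewrite -[RHS]class_of_val; apply/class_of_eq/(lcosetMl rG (val x)).
by rewrite mulldiv; exact: lcoset_class_of.
Qed.

Let rdivmulK x y : rdivK x y * y = x.
Proof.
rewrite -[RHS]class_of_val; apply/class_of_eq.
rewrite -[X in lcoset _ _ X](rdivmul _ (val y)).
by apply: (iffLR (lcosetMr rG nG mG _ _ _)); exact: lcoset_class_of.
Qed.

Let mulrdivK x y : rdivK (x * y) y = x.
Proof.
rewrite -[RHS]class_of_val; apply/class_of_eq/(lcosetMr rG nG mG (val y)).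
by rewrite rdivmul; exact: lcoset_class_of.
Qed.

HB.instance Definition _ :=
  UMagma_isLoop.Build K mulldivK ldivmulK rdivmulK mulrdivK.

Lemma transversal_loop_val1 : val (1 : K) = 1.
Proof. by []. Qed.

Lemma transversal_defect_subproof u : ldiv (val (class_of u)) u \in (G : set L).
Proof.
have [g Gg e] := lcoset_class_of u.
by rewrite -[X in ldiv _ X]e ldivmul; exact: mem_set.
Qed.

(** The [G]-component of [u]; on products of two representatives it is the factor set of the
    extension. *)
Definition transversal_defect (u : L) : sg_type G :=
  SigSub (transversal_defect_subproof u).

Lemma transversal_defectE u : val (class_of u) * val (transversal_defect u) = u.
Proof. exact: mulldiv. Qed.

Lemma transversal_defect_val x : transversal_defect (val x) = 1.
Proof.
apply: val_inj; apply: (@loop_mulI _ (val x)).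
by rewrite -[X in val X * _]class_of_val transversal_defectE val_sg1 mulg1.
Qed.

Let defect1r x : transversal_defect (val x * val (1 : K)) = 1.
Proof. by rewrite transversal_loop_val1 mulg1 transversal_defect_val. Qed.

Let defect1l x : transversal_defect (val (1 : K) * val x) = 1.
Proof. by rewrite transversal_loop_val1 mul1g transversal_defect_val. Qed.

Definition transversal_schreier_data : schreier_data K (sg_type G) :=
  @SchreierData K (sg_type G) (fun x y => transversal_defect (val x * val y))
    (fun=> id_automorphism _) defect1r defect1l (frefl _).

Definition transversal_decomposition (p : schreier_ext transversal_schreier_data)
  : L := val p.1 * val p.2.

Lemma transversal_decompositionP : A `<=` commutant G ->
  schreier_decomposition transversal_decomposition.
Proof.
move=> cA; split.
- exists (fun u => (class_of u, transversal_defect u)) => [[x s]|u].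
    rewrite /transversal_decomposition /=.
    have e : class_of (val x * val s) = x.
      rewrite -[RHS]class_of_val; apply/esym/class_of_eq.
      by exists (val s) => //; exact: set_valP.
    congr pair => //; apply: val_inj; apply: (@loop_mulI _ (val x)).
    by rewrite -{1}e transversal_defectE.
  exact: transversal_defectE.
- move=> [x s] [y t].
  rewrite -[LHS]/(val (class_of (val x * val y)) *
                  val (transversal_defect (val x * val y) * s * t)).
  rewrite -[RHS]/((val x * val s) * (val y * val t)).
  have Gs := set_valP s; have Gt := set_valP t.
  rewrite -mulgA !val_sgM.
  rewrite -(rG (sgM Gs Gt)) transversal_defectE -(rG Gt) -[RHS](rG Gt).
  congr (_ * _).
  (* The goal [(x * y) * s = (x * s) * y] reduces by nuclearity of [s] to [y * s = s * y]; only here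
     does the commutant enter. *)
  by rewrite (rG Gs) (mG Gs) (cA _ (set_valP y) _ Gs).
- by move=> t; rewrite /transversal_decomposition /= mul1g.
Qed.

End TransversalLoop.

(** * The implications between the three conditions *)

Section Conditions.
Context {L : loopType} {G : subgroup L}.
Context (nG : normal_subloop G) (mG : G `<=` middle_nucleus L).
Context (rG : G `<=` right_nucleus L).

Lemma automorphism_free_of_transversal (A : set L) :
  left_transversal G A -> A `<=` commutant G ->
  has_automorphism_free_decomposition G.
Proof.
move=> tA cA; exists (transversal_loop nG mG rG tA).
exists (transversal_schreier_data nG mG rG tA).
exists (@transversal_decomposition _ _ _ nG mG rG tA).
by split=> [|x s //]; exact: transversal_decompositionP.
Qed.

Lemma inner_of_automorphism_free (x : L) :
  has_automorphism_free_decomposition G -> inner (T_aut nG mG rG x).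
Proof.
case=> K [D [F [[[F' FK F'K] FM F1] Dfree]]].
case e: (F' x) => [sigma s]; exists s^-1 => g.
apply: val_inj; apply: (@loop_mulIr L x); rewrite [LHS]T_funE.
(* Both [x * g] and [(s * g * s^-1) * x] are the image under [F] of [(sigma, s * g)]. *)
rewrite -(F'K x) e -!F1 -!FM !schreier_mulE /= !Dfree sch_f1l sch_f1r.
by rewrite mulg1 !mul1g /conjg invgK -!mulgA mulVg mulg1.
Qed.

Lemma lcoset_commutant (x : L) : inner (T_aut nG mG rG x) ->
  exists2 u, commutant G u & lcoset x G u.
Proof.
case=> h Th; have Gh := set_valP h; exists (x * val h); last by exists (val h).
move=> g Gg; pose s : sg_type G := SigSub (mem_set Gg).
(* This argument is the preimage of [g] under [T_x], which is conjugation by [h]. *)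
have /(congr1 val) Tg := Th (h * s * h^-1).
have {}Tg : val (T_fun nG x (h * s * h^-1)) = g.
  by rewrite [LHS]Tg conjgE -!mulgA mulVg mulg1 mulKg.
(* [g * (x * h) = (g * x) * h = (x * (h * g * h^-1)) * h = x * (h * g)]. *)
rewrite -(rG Gh) -Tg T_funE (rG Gh) Tg (rG Gg).
by rewrite -!val_sgM -!mulgA mulVg mulg1.
Qed.

Lemma commutant_transversal : (forall x : L, inner (T_aut nG mG rG x)) ->
  exists A : set L, left_transversal G A /\ A `<=` commutant G.
Proof.
move=> Tinner.
(* The last clause forces the representative of [G] itself to be 1, as a transversal contains the
   identity. *)
pose good (S : set L) := [set u | [/\ S u, commutant G u & S 1 -> u = 1]].
(* The choice depends on [x] only through its coset as a set, whence uniqueness; by [cP] the default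
   1 is never a fallback. *)
pose c x := xget 1 (good (lcoset x G)).
have cP x : good (lcoset x G) (c x).
  suff : exists u, good (lcoset x G) u by exact: xgetPex.
  have [x1|nx1] := pselect (lcoset x G 1).
    by exists 1; split=> // g _; rewrite mul1g mulg1.
  by have [u Cu xu] := lcoset_commutant (Tinner x); exists u.
exists (range c); split; last by move=> _ [x _ <-]; have [] := cP x.
split.
  by exists 1 => //; have [_ _] := cP 1; apply; exact: lcoset_refl.
move=> x; exists (c x); split; first by split; [exists x|have [] := cP x].
move=> _ [[y _ <-] xcy]; have [ycy _ _] := cP y.
by rewrite /c -(lcoset_eq rG xcy) (lcoset_eq rG ycy).
Qed.

End Conditions.

Theorem theorem48 (L : loopType) (G : subgroup L)
    (nG : normal_subloop G)
    (mG : G `<=` middle_nucleus L)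
    (rG : G `<=` right_nucleus L) :
  (has_automorphism_free_decomposition G
     <-> (forall x : L, inner (T_aut nG mG rG x)))
  /\ ((forall x : L, inner (T_aut nG mG rG x))
     <-> (exists A : set L, left_transversal G A /\ A `<=` commutant G)).
Proof.
(* The equivalences follow from a cycle: transversal, decomposition, inner [T_x], transversal. *)
have BF : (exists A : set L, left_transversal G A /\ A `<=` commutant G) ->
    has_automorphism_free_decomposition G.
  by case=> A [tA cA]; exact: (automorphism_free_of_transversal nG mG rG tA cA).
have FA : has_automorphism_free_decomposition G ->
    forall x : L, inner (T_aut nG mG rG x).
  by move=> F x; exact: inner_of_automorphism_free.
have AB := @commutant_transversal L G nG mG rG.
by split; split=> //; [move=> /AB/BF|move=> /BF/FA].
Qed.
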